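(* For every $m\ge0$ there exists a finite simple skew brace $B_m$ such that $(B_m,+)\cong A_4^{2^m}$ and $(B_m,\circ)$ is solvable.
   Context: A skew brace is a triple $(B,+,\circ)$ such that $(B,+)$ and $(B,\circ)$ are groups (neither assumed abelian) on the same set and $a\circ(b+c)=a\circ b-a+a\circ c$ for all $a,b,c\in B$. The two identity elements coincide and are denoted $0$. Its lambda map is $\lambda^B:(B,\circ)\to\mathrm{Aut}(B,+)$, $\lambda^B_a(b)=-a+a\circ b$. An ideal is a subgroup $I\le(B,+)$ with $I\trianglelefteq(B,+)$, $I\trianglelefteq(B,\circ)$ and $\lambda^B_a(I)=I$ for all $a\in B$. A non-zero skew brace is simple if its only ideals are $0$ and $B$. $A_4$ is the alternating group of degree $4$. *)

(* Defs.v *)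
From HB Require Import structures.
From mathcomp Require Import all_boot all_fingroup all_solvable.

Set Implicit Arguments.
Unset Strict Implicit.
Unset Printing Implicit Defensive.

Declare Scope skew_scope.
Delimit Scope skew_scope with sb.

Record finSkewBrace := FinSkewBrace {
  sb_sort :> finType;
  sb_zero : sb_sort;
  sb_opp : sb_sort -> sb_sort;
  sb_add : sb_sort -> sb_sort -> sb_sort;
  sb_one : sb_sort;
  sb_inv : sb_sort -> sb_sort;
  sb_circ : sb_sort -> sb_sort -> sb_sort;
  sb_addA : associative sb_add;
  sb_add0 : left_id sb_zero sb_add;
  sb_addN : left_inverse sb_zero sb_opp sb_add;
  sb_circA : associative sb_circ;
  sb_circ1 : left_id sb_one sb_circ;
  sb_circV : left_inverse sb_one sb_inv sb_circ;
  sb_circD : forall a b c : sb_sort,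
    sb_circ a (sb_add b c) =
      sb_add (sb_add (sb_circ a b) (sb_opp a)) (sb_circ a c)
}.

Arguments sb_zero {_}.
Arguments sb_one {_}.

Notation "0" := sb_zero : skew_scope.
Notation "- a" := (sb_opp a) : skew_scope.
Notation "a + b" := (sb_add a b) : skew_scope.
Notation "a \circ b" := (sb_circ a b)
  (at level 40, left associativity) : skew_scope.

(* Aliases of the carrier, so that each of the two laws gets its own canonical
   (multiplicatively written) finGroupType. *)
Definition addGroup (B : finSkewBrace) : Type := B.
Definition circGroup (B : finSkewBrace) : Type := B.

HB.instance Definition _ (B : finSkewBrace) := Finite.copy (addGroup B) B.
HB.instance Definition _ (B : finSkewBrace) :=
  Finite_isGroup.Build (addGroup B) (@sb_addA B) (@sb_add0 B) (@sb_addN B).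

HB.instance Definition _ (B : finSkewBrace) := Finite.copy (circGroup B) B.
HB.instance Definition _ (B : finSkewBrace) :=
  Finite_isGroup.Build (circGroup B) (@sb_circA B) (@sb_circ1 B) (@sb_circV B).

Lemma sb_oneE (B : finSkewBrace) : @sb_one B = 0%sb.
Proof.
have e : (sb_one \circ (0 + 0) = sb_one \circ 0 + - sb_one + sb_one \circ 0
           :> B)%sb by exact: sb_circD.
rewrite !sb_circ1 !sb_add0 in e.
have n1 : (- sb_one = 0 :> B)%sb.
  by move: e; rewrite -[RHS]/(((- sb_one)%sb : addGroup B) * 1)%g mulg1.
by have := sb_addN (sb_one : B); rewrite n1 sb_add0.
Qed.

Definition lambda (B : finSkewBrace) (a b : B) : B := (- a + a \circ b)%sb.

(* The same subset, regarded in each of the two groups. *)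
Definition add_set (B : finSkewBrace) (I : {set B}) : {set addGroup B} :=
  [set x : addGroup B | (x : B) \in I].
Definition circ_set (B : finSkewBrace) (I : {set B}) : {set circGroup B} :=
  [set x : circGroup B | (x : B) \in I].

Definition ideal (B : finSkewBrace) (I : {set B}) : Prop :=
  [/\ group_set (add_set I) /\ (add_set I <| [set: addGroup B])%g,
      group_set (circ_set I) /\ (circ_set I <| [set: circGroup B])%g
    & forall a : B, lambda a @: I = I].

Definition simple_brace (B : finSkewBrace) : Prop :=
  [set: B] <> [set 0%sb] /\
  forall I : {set B}, ideal I -> I = [set 0%sb] \/ I = [set: B].

(* Main.v *)
Require Import Defs.
From mathcomp Require Import all_boot all_fingroup all_solvable.

Set Implicit Arguments.
Unset Strict Implicit.
Unset Printing Implicit Defensive.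

(* Let chi : (B, o) -> Z/2 be a homomorphism. The kernel of the homomorphism
   (a, b, s^i) |-> chi a + chi b + i on the wreath product (B, o) wr <s> acts
   regularly on B^2, so it is the circle group of a skew brace on the additive
   group B^2, and chi a + chi b is again a homomorphism to Z/2. This doubling
   starts from A_4 = V_4 : C_3 with circle group C_3 : C_4. Inductively, with
   V = [B, B] = V_4^(2^m), the additively normal lambda-invariant subgroups are
   only 1, V and B: every nontrivial one contains V because the factors are
   permuted transitively, and B/V is an irreducible lambda-module over F_3.
   Finally V is not an ideal, since some v in V acts nontrivially on B/V. *)

Local Open Scope group_scope.

(** * Calculus of the lambda map in the additive group *)

Section LambdaMap.

Variable B : finSkewBrace.
Implicit Types a b x y : addGroup B.

Definition lam a x : addGroup B := lambda a x.
Definition circ a x : addGroup B := sb_circ a x.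

Lemma circE a x : circ a x = a * lam a x.
Proof. by rewrite /lam /lambda -[RHS]/(a * (a^-1 * circ a x)) mulKVg. Qed.

Lemma circA a b x : circ a (circ b x) = circ (circ a b) x.
Proof. exact: sb_circA. Qed.

Lemma circ1g x : circ 1 x = x.
Proof. by rewrite -[1]/(sb_zero : addGroup B) -sb_oneE; apply: sb_circ1. Qed.

Lemma lamM a x y : lam a (x * y) = lam a x * lam a y.
Proof.
have e : circ a (x * y) = circ a x * a^-1 * circ a y by apply: sb_circD.
by apply: (mulgI a); rewrite -circE e [RHS]mulgA -circE (circE a y) -mulgA mulKg.
Qed.

Lemma lam1 a : lam a 1 = 1.
Proof. by apply: (mulgI (lam a 1)); rewrite -lamM !mulg1. Qed.

Lemma lam_circ a b x : lam (circ a b) x = lam a (lam b x).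
Proof.
by have := circA a b x; rewrite !circE lamM mulgA => /mulgI.
Qed.

Lemma lam1g x : lam 1 x = x.
Proof. by have := circE 1 x; rewrite circ1g mul1g. Qed.

Lemma lamK a : cancel (lam a) (lam (sb_inv a)).
Proof.
move=> x; rewrite -lam_circ -[RHS]lam1g; congr (lam _ x).
by rewrite /circ sb_circV sb_oneE.
Qed.

(** The additive and lambda conditions on an ideal. They are kept apart because they can be followed
    through doubling; normality for the circle law enters only to exclude [V]. *)
Definition strong_left_ideal (N : {group addGroup B}) : Prop :=
  (forall x y, x \in N -> x ^ y \in N) /\
  (forall a x, x \in N -> lam a x \in N).

Lemma mem_lam N a x : strong_left_ideal N -> (lam a x \in N) = (x \in N).
Proof.
case=> _ sN; apply/idP/idP => [/(sN (sb_inv a : addGroup B))|/(sN a)//].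
by rewrite lamK.
Qed.

End LambdaMap.

(** * Doubling a skew brace along a homomorphism to Z/2 *)

Section Double.

Variables (B : finSkewBrace) (chi : B -> bool).
Hypothesis chiM : forall a b, chi (sb_circ a b) = chi a (+) chi b.

Lemma chi_one : chi sb_one = false.
Proof. by have := chiM sb_one sb_one; rewrite sb_circ1; case: (chi _). Qed.

Lemma chi_zero : chi sb_zero = false.
Proof. by rewrite -sb_oneE chi_one. Qed.

Lemma chiV a : chi (sb_inv a) = chi a.
Proof.
have := chiM (sb_inv a) a.
by rewrite sb_circV chi_one; case: (chi a); case: (chi _).
Qed.

Definition dbl_chi (a : B * B) := chi a.1 (+) chi a.2.

(** The pair [a] stands for the wreath product element (a.1, a.2, s^i) in the kernel, which forces i
    = [dbl_chi a]; the formula is its action on the pair [x]. *)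
Definition dbl_circ (a x : B * B) : B * B :=
  if dbl_chi a then (sb_circ a.1 x.2, sb_circ a.2 x.1)
  else (sb_circ a.1 x.1, sb_circ a.2 x.2).

Definition dbl_inv (a : B * B) : B * B :=
  if dbl_chi a then (sb_inv a.2, sb_inv a.1) else (sb_inv a.1, sb_inv a.2).

Definition dbl_add (x y : B * B) : B * B := (sb_add x.1 y.1, sb_add x.2 y.2).

Lemma dbl_chiM a b : dbl_chi (dbl_circ a b) = dbl_chi a (+) dbl_chi b.
Proof.
rewrite /dbl_circ; case: ifP; rewrite /dbl_chi /= !chiM;
by case: (chi a.1); case: (chi a.2); case: (chi b.1); case: (chi b.2).
Qed.

Lemma dbl_addA : associative dbl_add.
Proof. by move=> x y z; rewrite /dbl_add /= !sb_addA. Qed.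

Lemma dbl_add0 : left_id (sb_zero, sb_zero) dbl_add.
Proof. by case=> x y; rewrite /dbl_add /= !sb_add0. Qed.

Lemma dbl_addN :
  left_inverse (sb_zero, sb_zero) (fun x => (sb_opp x.1, sb_opp x.2)) dbl_add.
Proof. by case=> x y; rewrite /dbl_add /= !sb_addN. Qed.

(** By [dbl_chiM] the swaps made by [a] and [b] compose to the one made by their product; each
    coordinate then reduces to associativity in [B]. *)
Lemma dbl_circA : associative dbl_circ.
Proof.
move=> a b x; rewrite [in RHS]/dbl_circ dbl_chiM [dbl_circ b x]/dbl_circ.
rewrite /dbl_circ.
by case: (dbl_chi a); case: (dbl_chi b); rewrite /= !sb_circA.
Qed.

Lemma dbl_circ1 : left_id (sb_one, sb_one) dbl_circ.
Proof.
by case=> x y; rewrite /dbl_circ /dbl_chi /= chi_one /= !sb_circ1.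
Qed.

Lemma dbl_circV : left_inverse (sb_one, sb_one) dbl_inv dbl_circ.
Proof.
case=> x y; rewrite /dbl_circ /dbl_inv.
case e: (dbl_chi (x, y)); rewrite /dbl_chi /= !chiV ?[chi y (+) _]addbC.
  by move: e; rewrite /dbl_chi /= => ->; rewrite /= !sb_circV.
by move: e; rewrite /dbl_chi /= => ->; rewrite /= !sb_circV.
Qed.

(** The swap is an automorphism of the additive group, so the law can be checked coordinate by
    coordinate. *)
Lemma dbl_circD a b c :
  dbl_circ a (dbl_add b c) =
  dbl_add (dbl_add (dbl_circ a b) (sb_opp a.1, sb_opp a.2)) (dbl_circ a c).
Proof. by rewrite /dbl_circ; case: ifP => _; rewrite /dbl_add /= !sb_circD. Qed.

Definition dbl : finSkewBrace :=
  FinSkewBrace dbl_addA dbl_add0 dbl_addN dbl_circA dbl_circ1 dbl_circV dbl_circD.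

Definition dblp (x y : addGroup B) : addGroup dbl := (x, y).

Lemma dblpM x y x' y' : dblp x y * dblp x' y' = dblp (x * x') (y * y').
Proof. by []. Qed.

Lemma dblpV x y : (dblp x y)^-1 = dblp x^-1 y^-1.
Proof. by []. Qed.

Lemma dblpJ x y x' y' : dblp x y ^ dblp x' y' = dblp (x ^ x') (y ^ y').
Proof. by []. Qed.

Lemma dblp_lam (a b x y : addGroup B) :
  lam (dblp a b) (dblp x y) =
  if chi a (+) chi b then dblp (lam a y) (lam b x)
  else dblp (lam a x) (lam b y).
Proof.
rewrite /lam /lambda /= /dbl_circ /dbl_chi /=.
by case: ifP.
Qed.

End Double.

(** * The three-step lattice of strong left ideals, and simplicity *)

(** [ts_min] and [ts_max] leave only 1, [V] and the whole group. The other fields feed the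
    induction: [ts_center] produces commutators inside one factor, [ts_exp3] and [ts_neg] give -1 on
    an exponent 3 quotient, and the odd element of [ts_act] exchanges the factors. [ts_act] also
    prevents [V] from being an ideal. *)
Record three_step (B : finSkewBrace) (chi : B -> bool) (V : {group addGroup B})
    : Prop := ThreeStep {
  ts_center : forall x : addGroup B, (forall y, x ^ y = x) -> x = 1;
  ts_strong : strong_left_ideal V;
  ts_min : forall N : {group addGroup B},
    strong_left_ideal N -> N :!=: 1 -> V \subset N;
  ts_max : forall N : {group addGroup B}, strong_left_ideal N ->
    V \subset N -> forall z, z \in N -> z \notin V -> forall x, x \in N;
  ts_exp3 : forall x : addGroup B, x ^+ 3 \in V;
  ts_neg : exists u : addGroup B, forall x, lam u x * x \in V;
  ts_act : exists v x : addGroup B,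
    [/\ v \in V, chi v & lam v x * x^-1 \notin V]
}.

Lemma three_step_simple (B : finSkewBrace) (chi : B -> bool) V :
  chi sb_zero = false -> three_step chi V -> simple_brace B.
Proof.
move=> chi0 [_ [cV sV] minV maxV _ _ [v [x [Vv cv vx]]]]; split.
  move=> eT; have : (v : B) \in [set: B] by rewrite inE.
  by rewrite eT inE => /eqP ev; rewrite ev chi0 in cv.
move=> I [[gI nI] [gcI ncI] lamI].
have memI y : (y \in Group gI) = ((y : B) \in I) by rewrite inE.
have strI : strong_left_ideal (Group gI).
  split=> [y z Iy|a y].
    by rewrite memJ_norm //; apply: (subsetP (normal_norm nI)); rewrite inE.
  rewrite !memI => Iy; rewrite -[X in _ \in pred_of_set X](lamI a).
  exact: imset_f.
have [I1|I1] := eqVneq (Group gI :> {set _}) 1.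
  left; apply/setP=> y; rewrite -memI.
  have -> : (y \in Group gI) = (y \in (1 : {set addGroup B})) by rewrite -I1.
  by rewrite [RHS]inE; apply: in_set1.
right; have VI := minV _ strI I1.
(* In the first case the ideal equals [V], which must be refuted; in the second [maxV] makes it
   everything. *)
have [IV|[z Iz Vz]] : Group gI \subset V \/ exists2 z, z \in Group gI & z \notin V.
  by case: (boolP (Group gI \subset V)) => [|/subsetPn]; [left | right].
  (* Were V normal for circ, v o x = x o w with w in V would make v fix x V. *)
  case/negP: vx.
  have memV y : ((y : circGroup B) \in circ_set I) = (y \in V).
    by rewrite inE -memI; apply/idP/idP; [apply: (subsetP IV)|apply: (subsetP VI)].
  have : (v : circGroup B) ^ (x : circGroup B) \in circ_set I.
    rewrite memJ_norm; first by rewrite memV.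
    by apply: (subsetP (normal_norm ncI)); rewrite inE.
  rewrite memV; set w := (_ ^ _) => Vw.
  have e : circ v x = circ x w.
    by have := conjgC (v : circGroup B) (x : circGroup B).
  rewrite !circE in e.
  have -> : lam v x = v^-1 * (x * lam x w) by rewrite -e mulKg.
  rewrite -(mulgA v^-1) -(mulgA x (lam x w)) groupM ?groupV //.
  by have := cV (lam x w) x^-1 (sV x w Vw); rewrite /conjg invgK.
by apply/setP=> y; rewrite -memI [RHS]inE (maxV _ strI VI _ Iz Vz).
Qed.

(** * Strong left ideals of the double *)

Section DoubleStep.

Variables (B : finSkewBrace) (chi : B -> bool).
Hypothesis chiM : forall a b, chi (sb_circ a b) = chi a (+) chi b.
Variable V : {group addGroup B}.

Local Notation BB := (dbl chiM).
Local Notation "<( x , y )>" := (dblp chiM x y) (format "<( x ,  y )>").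

Lemma dblp_ind (P : addGroup BB -> Prop) :
  (forall x y, P <(x, y)>) -> forall z, P z.
Proof. by move=> Pxy [x y]; apply: Pxy. Qed.

Lemma dblp_inj x y x' y' : <(x, y)> = <(x', y')> -> x = x' /\ y = y'.
Proof. by case. Qed.

Definition dbl_group_set : {set addGroup BB} :=
  [set z : addGroup BB | ((z : B * B).1 \in V) && ((z : B * B).2 \in V)].

Lemma dbl_group_setP : group_set dbl_group_set.
Proof.
apply/group_setP; split=> [|z t]; rewrite !inE.
  by apply/andP; split; apply: group1.
by case/andP=> z1 z2 /andP[t1 t2]; apply/andP; split; apply: groupM.
Qed.
Canonical dbl_group := Group dbl_group_setP.

Lemma in_dbl_group x y : (<(x, y)> \in dbl_group) = (x \in V) && (y \in V).
Proof. by rewrite inE. Qed.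

Definition slice_set (N : {group addGroup BB}) : {set addGroup B} :=
  [set x | <(x, 1)> \in N].

Lemma slice_setP N : group_set (slice_set N).
Proof.
apply/group_setP; split=> [|z t]; rewrite !inE; first exact: group1.
by rewrite -{3}[1]mulg1; apply: groupM.
Qed.
Canonical slice N := Group (slice_setP N).

Lemma in_slice N x : (x \in slice N) = (<(x, 1)> \in N).
Proof. by rewrite inE. Qed.

(* For N/V^2 inside (B/V)^2: N contains a nonzero vector supported on the first
   factor, which is what makes (B/V)^2 irreducible when B/V is. *)
Definition splitting : Prop := forall (N : {group addGroup BB}) x y,
  strong_left_ideal N -> dbl_group \subset N -> <(x, y)> \in N ->
  x \notin V -> y \notin V -> exists2 z, z \notin V & <(z, 1)> \in N.

Hypothesis tsV : three_step chi V.

Let chi0 : chi (1 : addGroup B) = false.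
Proof. exact: chi_zero. Qed.

(** A diagonal pair [(a, a)] is even for [dbl_chi], so it acts by [lam a] on each factor without a
    swap. *)
Lemma slice_strong N : strong_left_ideal N -> strong_left_ideal (slice N).
Proof.
case=> cN lN; split=> [x y|a x]; rewrite !in_slice => Nx.
  by have := cN _ <(y, 1)> Nx; rewrite dblpJ conj1g.
by have := lN <(a, a)> _ Nx; rewrite dblp_lam addbb lam1.
Qed.

(** With [v] odd, [(v, 1)] exchanges the two factors. *)
Lemma slice_swap N x : strong_left_ideal N -> <(1, x)> \in N ->
  exists2 v, v \in V & <(lam v x, 1)> \in N.
Proof.
case=> _ lN Nx; have [v [_ [Vv cv _]]] := ts_act tsV.
exists v => //; have := lN <(v, 1)> _ Nx.
by rewrite dblp_lam cv chi0 /= lam1.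
Qed.

Lemma swap_slice N x : strong_left_ideal N -> <(x, 1)> \in N -> <(1, x)> \in N.
Proof.
case=> _ lN Nx; have [v [_ [Vv cv _]]] := ts_act tsV.
by have := lN <(v, 1)> _ Nx; rewrite dblp_lam cv chi0 /= lam1 lam1g.
Qed.

Lemma slice_full N : strong_left_ideal N ->
  (forall x, <(x, 1)> \in N) -> forall x y, <(x, y)> \in N.
Proof.
move=> sN Nx x y; rewrite -[x]mulg1 -[y]mul1g -dblpM groupM //.
exact: swap_slice.
Qed.

(** Since [k] is even, [(k, 1)] fixes the second coordinate and negates the first modulo [V].
    Dividing by the image leaves x^2 modulo [V] in the first factor, and x^2 is outside [V] because
    x^3 is inside. *)
Lemma splitting_neg (k : addGroup B) : chi k = false ->
  (forall x, lam k x * x \in V) -> splitting.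
Proof.
move=> ck kV N x y [cN lN] _ Nxy Vx _; exists (x * (lam k x)^-1).
  apply/negP=> h; case/negP: Vx.
  have h2 : x * x \in V.
    by have := groupM h (kV x); rewrite mulgA mulgKV.
  by have := ts_exp3 tsV x; rewrite expgS expg2 groupMr.
have := lN <(k, 1)> _ Nxy; rewrite dblp_lam ck chi0 /= lam1g => h.
by have := groupM Nxy (groupVr h); rewrite dblpV dblpM mulgV.
Qed.

Lemma dbl_three_step : splitting -> @three_step BB (dbl_chi chi) dbl_group.
Proof.
move=> split_N; have [ctr sV minV maxV exp3 [u neg] [v [x0 [Vv cv vx0]]]] := tsV.
split.
- elim/dblp_ind=> x y xy; congr (dblp _ _ _).
    by apply: ctr => t; have := xy <(t, 1)>; rewrite dblpJ => /dblp_inj[].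
  by apply: ctr => t; have := xy <(1, t)>; rewrite dblpJ => /dblp_inj[].
- split; elim/dblp_ind=> a b; elim/dblp_ind=> x y.
    by rewrite dblpJ !in_dbl_group => /andP[Va Vb]; rewrite !(sV.1).
  rewrite in_dbl_group dblp_lam => /andP[Vx Vy].
  by case: ifP => _; rewrite in_dbl_group !(sV.2).
- move=> N sN N1.
  have sJ := slice_strong sN.
  (* As [x] is not central, some commutator of [(x, y)] with [(a, 1)] is a nontrivial element of the
     first factor. *)
  have J1 x y : <(x, y)> \in N -> x != 1 -> V \subset slice N.
    move=> Nx x1; apply: minV => //.
    have [a xa] : exists a, x ^ a != x.
      apply/existsP; apply: contraR x1 => /existsPn h.
      by apply/eqP/ctr => a; apply/eqP/negPn/h.
    apply/trivgPn; exists (x^-1 * x ^ a); last by rewrite -eq_mulVg1 eq_sym.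
    rewrite in_slice -[1](mulVg y) -dblpM -dblpV groupM ?groupV //.
    by rewrite -[y in <(_, y)>]conjg1 -dblpJ; apply: sN.1.
  have VJ : V \subset slice N.
    case/trivgPn: N1; elim/dblp_ind=> x y Nxy xy1.
    have [x1|] := eqVneq x 1; last exact: (J1 x y).
    have {}Nxy : <(1, y)> \in N by rewrite -x1.
    have [w _ Nw] := slice_swap sN Nxy; apply: (J1 _ _ Nw).
    apply: contraNneq xy1 => lw1; rewrite x1.
    have -> : y = 1 by rewrite -[y](lamK w) lw1 lam1.
    by [].
  apply/subsetP; elim/dblp_ind=> x y; rewrite in_dbl_group.
  case/andP=> /(subsetP VJ) + /(subsetP VJ); rewrite !in_slice => Nx Ny.
  by rewrite -[x]mulg1 -[y]mul1g -dblpM groupM //; apply: swap_slice.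
- move=> N sN VN; elim/dblp_ind=> x y Nxy Vxy; elim/dblp_ind=> x' y'.
  apply: slice_full => // t; rewrite -in_slice.
  (* A coordinate in [V] can be cancelled, since [N] contains [dbl_group]; [split_N] handles the
     case where neither lies in [V]. *)
  have [z Vz Nz] : exists2 z, z \notin V & <(z, 1)> \in N.
    have inN x1 y1 : x1 \in V -> y1 \in V -> <(x1, y1)> \in N.
      by move=> *; apply: (subsetP VN); rewrite in_dbl_group; apply/andP.
    have [Vx|Vx] := boolP (x \in V).
      have Vy : y \notin V.
        by apply: contra Vxy => Vy; rewrite in_dbl_group Vx.
      have Ny : <(1, y)> \in N.
        have := groupM (inN x^-1 1 (groupVr Vx) (group1 _)) Nxy.
        by rewrite dblpM mulVg mul1g.
      have [w _ Nw] := slice_swap sN Ny.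
      by exists (lam w y) => //; rewrite (mem_lam _ _ sV).
    have [Vy|Vy] := boolP (y \in V); last exact: (split_N N x y).
    exists x => //.
    have := groupM Nxy (inN 1 y^-1 (group1 _) (groupVr Vy)).
    by rewrite dblpM mulgV mulg1.
  have sJ := slice_strong sN.
  apply: (maxV _ sJ) Vz _ => //; last by rewrite in_slice.
  apply/subsetP=> w Vw; rewrite in_slice; apply: (subsetP VN).
  by rewrite in_dbl_group Vw group1.
- elim/dblp_ind=> x y; rewrite -[_ ^+ 3]/<(x ^+ 3, y ^+ 3)> in_dbl_group.
  by rewrite !exp3.
- exists <(u, u)>; elim/dblp_ind=> x y; rewrite dblp_lam addbb dblpM.
  by rewrite in_dbl_group !neg.
exists <(v, 1)>, <(x0, 1)>; split; first by rewrite in_dbl_group Vv group1.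
  by rewrite /dbl_chi /= cv chi0.
rewrite dblp_lam cv chi0 /= lam1 lam1g dblpV dblpM in_dbl_group mul1g.
apply: contra vx0 => /andP[]; rewrite groupV => Vx _.
by rewrite groupM ?groupV // sV.2.
Qed.

End DoubleStep.

(** * The base skew brace on A_4, in coordinates *)

Definition klein := (bool * bool)%type.
(* [None], [Some false] and [Some true] stand for 0, 1 and 2 modulo 3. *)
Definition three := option bool.

Definition add4 (v w : klein) : klein := (v.1 (+) w.1, v.2 (+) w.2).
Definition opp3 (i : three) : three := omap negb i.
Definition add3 (i j : three) : three :=
  match i, j with
  | None, _ => j
  | _, None => i
  | Some a, Some b => if a (+) b then None else Some (~~ a)
  end.
(** The powers of a matrix of order 3 in GL_2(F_2), through which C_3 acts on V_4. *)
Definition turn (i : three) (v : klein) : klein :=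
  match i with
  | None => v
  | Some false => (v.2, v.1 (+) v.2)
  | Some true => (v.1 (+) v.2, v.1)
  end.

Definition a4 := (klein * three)%type.
Definition a4_zero : a4 := ((false, false), None).
Definition a4_add (a b : a4) : a4 := (add4 a.1 (turn a.2 b.1), add3 a.2 b.2).
Definition a4_opp (a : a4) : a4 := (turn (opp3 a.2) a.1, opp3 a.2).

(** This linear form on V_4 is invariant under the coordinate swap, hence multiplicative for
    [a4_circ]. *)
Definition a4_chi (a : a4) : bool := a.1.1 (+) a.1.2.
(* Writing a = v + c with v in V_4 and c in C_3, a o b = v + s^(chi v)(b) + c,
   where s is the automorphism swapping the coordinates of V_4 and inverting C_3. *)
Definition a4_circ (a b : a4) : a4 :=
  if a4_chi a then (add4 a.1 (b.1.2, b.1.1), add3 a.2 (opp3 b.2))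
  else (add4 a.1 b.1, add3 a.2 b.2).
Definition a4_inv (a : a4) : a4 :=
  if a4_chi a then ((a.1.2, a.1.1), a.2) else (a.1, opp3 a.2).

(** An explicit list, so that quantifiers over the 12 elements become boolean tests that
    evaluate. *)
Definition a4_enum : seq a4 :=
  [seq (v, i) | v <- [seq (b, c) | b <- [:: false; true], c <- [:: false; true]],
                i <- [:: None; Some false; Some true]].

Lemma mem_a4_enum a : a \in a4_enum.
Proof. by case: a => [[[] []] [[]|]]. Qed.

Lemma a4_all (P : pred a4) : all P a4_enum -> forall a, P a.
Proof. by move=> /allP allP a; apply: allP; apply: mem_a4_enum. Qed.

Lemma a4_all2 (P : a4 -> pred a4) :
  all (fun a => all (P a) a4_enum) a4_enum -> forall a b, P a b.
Proof. by move=> /a4_all h a b; apply: a4_all. Qed.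

Lemma a4_all3 (T : eqType) (f g : a4 -> a4 -> a4 -> T) :
  all (fun a => all (fun b => all (fun c => f a b c == g a b c) a4_enum) a4_enum)
    a4_enum -> forall a b c, f a b c = g a b c.
Proof.
move=> h a b c; apply/eqP.
by move: c; apply: a4_all; move: b; apply: a4_all; move: a; apply: a4_all.
Qed.

Lemma a4_addA : associative a4_add.
Proof. by apply: a4_all3; vm_compute. Qed.
Lemma a4_add0 : left_id a4_zero a4_add.
Proof. by case=> [[[] []] [[]|]]. Qed.
Lemma a4_addN : left_inverse a4_zero a4_opp a4_add.
Proof. by case=> [[[] []] [[]|]]. Qed.
Lemma a4_circA : associative a4_circ.
Proof. by apply: a4_all3; vm_compute. Qed.
Lemma a4_circ1 : left_id a4_zero a4_circ.
Proof. by case=> [[[] []] [[]|]]. Qed.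
Lemma a4_circV : left_inverse a4_zero a4_inv a4_circ.
Proof. by case=> [[[] []] [[]|]]. Qed.
Lemma a4_circD a b c :
  a4_circ a (a4_add b c) = a4_add (a4_add (a4_circ a b) (a4_opp a)) (a4_circ a c).
Proof. by move: a b c; apply: a4_all3; vm_compute. Qed.
Lemma a4_chiM a b : a4_chi (a4_circ a b) = a4_chi a (+) a4_chi b.
Proof. by case: a => [[[] []] [[]|]]; case: b => [[[] []] [[]|]]. Qed.

Definition a4_brace : finSkewBrace :=
  FinSkewBrace a4_addA a4_add0 a4_addN a4_circA a4_circ1 a4_circV a4_circD.

Local Notation A4 := (addGroup a4_brace).

Definition a4_in_V (a : A4) : bool := (a : a4).2 == None.

Definition a4_V_set : {set A4} := [set a | a4_in_V a].

Lemma a4_V_setP : group_set a4_V_set.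
Proof.
apply/group_setP; split=> [|a b]; rewrite !inE //.
move=> Va Vb; apply/(implyP _ Vb)/(implyP _ Va).
by move: b {Vb}; apply: a4_all; move: a {Va}; apply: a4_all; vm_compute.
Qed.
Canonical a4_V := Group a4_V_setP.

Lemma in_a4_V (a : A4) : (a \in a4_V) = a4_in_V a.
Proof. by rewrite inE. Qed.

Lemma a4_three_step : @three_step a4_brace a4_chi a4_V.
Proof.
split.
- have : forall x : A4, (x == 1) || has (fun y : A4 => x ^ y != x) a4_enum.
    by apply: a4_all.
  move=> h x xC; have := h x; case/orP=> [/eqP//|/hasP[y _]].
  by rewrite xC eqxx.
- split=> [x y|a x]; rewrite !in_a4_V.
    by apply/implyP; move: y; apply: a4_all; move: x; apply: a4_all.
  by apply/implyP; move: x; apply: a4_all; move: a; apply: a4_all.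
(* Two commutators are needed: for [x] in V_4, those of [x] with elements of A_4 give only 0 and the
   two other nonzero vectors, whose sum is [x]. *)
- have key : forall x v : A4, [|| x == 1, ~~ a4_in_V v |
      has (fun a : A4 => has (fun b : A4 =>
        v == (x^-1 * x ^ a) * (x^-1 * x ^ b)) a4_enum) a4_enum].
    by apply: a4_all2; vm_compute.
  move=> N [cN _] /trivgPn[x Nx x1]; apply/subsetP=> v; rewrite in_a4_V => Vv.
  case/or3P: (key x v); [by rewrite (negPf x1) | by rewrite Vv |].
  case/hasP=> a _ /hasP[b _ /eqP->].
  by apply: groupM; apply: groupM; rewrite ?groupV //; apply: cN.
(* The quotient by [V] has order 3, so [z] outside [V] generates it. *)
- have key : forall x z : A4, [|| a4_in_V z, a4_in_V x, a4_in_V (x * z)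
      | a4_in_V (x * z^-1)] by apply: a4_all2; vm_compute.
  move=> N _ /subsetP VN z Nz; rewrite in_a4_V => Vz x.
  have := key x z; rewrite (negPf Vz) /= -!in_a4_V => /or3P[] /VN //.
    by rewrite groupMr.
  by rewrite groupMr ?groupV.
- by move=> x; rewrite in_a4_V; move: x; apply: a4_all.
(* An odd element of V_4: its lambda map is [s], which inverts C_3. It serves again as [v] in
   [ts_act], with a generator of C_3 as [x]. *)
- exists (((true, false), None) : a4) => x; rewrite in_a4_V.
  by move: x; apply: a4_all.
exists (((true, false), None) : a4), (((false, false), Some true) : a4).
by split; rewrite ?in_a4_V.
Qed.

Local Notation dp := (@dblp a4_brace a4_chi a4_chiM).

(** Here only odd elements act as -1 modulo [V], so [splitting_neg] does not apply. Instead [(p, 1)]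
    sends (x, y) to (-y, x) modulo [V]. Over F_3 nonzero x and y satisfy y = x or y = -x;
    subtracting the image in the first case, adding it in the second, gives (2x, 0). *)
Lemma a4_splitting : @splitting a4_brace a4_chi a4_chiM a4_V.
Proof.
pose p : A4 := ((true, false), None).
have key : forall x y : A4, [|| a4_in_V x, a4_in_V y,
    a4_in_V (y * x^-1) && ~~ a4_in_V (x * (lam p y)^-1)
  | a4_in_V (y * x) && ~~ a4_in_V (x * lam p y)].
  by apply: a4_all2; vm_compute.
move=> N x y [_ lN] /subsetP VN Nxy.
rewrite !in_a4_V => Vx Vy.
have := lN (dp p 1) _ Nxy; rewrite dblp_lam lam1g => Nyx.
have slide a b : dp a b \in N -> a4_in_V b -> dp a 1 \in N.
  move=> Nab Vb; have Nb : dp 1 b^-1 \in N.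
    by apply: VN; rewrite in_dbl_group group1 groupV in_a4_V.
  by have := groupM Nab Nb; rewrite dblpM mulg1 mulgV.
have := key x y; rewrite (negPf Vx) (negPf Vy) /= => /orP[]/andP[Vyx Vz].
  exists (x * (lam p y)^-1); rewrite ?in_a4_V //.
  by apply: slide Vyx; rewrite -dblpM -dblpV groupM ?groupV.
exists (x * lam p y); rewrite ?in_a4_V //.
by apply: slide Vyx; rewrite -dblpM groupM.
Qed.

(** * Solvability of the circle groups *)

(** The kernel enters only as a subgroup on which [f] is trivial, so the lemma can be iterated with
    plain functions. *)
Lemma solvable_extension (gT rT : finGroupType) (G : {group gT}) (f : gT -> rT) :
  {in G &, {morph f : x y / x * y}} -> solvable [set: rT] ->
  (forall K : {group gT}, K \subset G -> {in K, forall x, f x = 1} -> solvable K) ->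
  solvable G.
Proof.
move=> fM solT solK; pose F := Morphism fM.
rewrite (series_sol (ker_normal F)) (isog_sol (first_isog F)).
rewrite (solvableS (subsetT _) solT) andbT; apply: solK.
  exact: subsetIl.
by move=> x /mker.
Qed.

Lemma bool_solvable : solvable [set: bool].
Proof. by apply: abelian_sol; apply/centsP=> x _ y _; apply: addbC. Qed.

(** On the kernel of [dbl_chi] no swap occurs, so both projections to the circle group of [B] are
    homomorphisms, and jointly injective. *)
Lemma dbl_solvable (B : finSkewBrace) (chi : B -> bool)
    (chiM : forall a b, chi (sb_circ a b) = chi a (+) chi b) :
  solvable [set: circGroup B] -> solvable [set: circGroup (dbl chiM)].
Proof.
move=> solB.
apply: (@solvable_extension _ _ [set: circGroup (dbl chiM)]%G (dbl_chi chi)).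
- by move=> a b _ _; apply: dbl_chiM.
- exact: bool_solvable.
move=> K _ chiK.
apply: (@solvable_extension _ (circGroup B) K (fun a => (a : B * B).1)) => //.
  by move=> a b Ka _; rewrite /= -[a * b]/(dbl_circ chi a b) /dbl_circ chiK.
move=> L LK L1.
apply: (@solvable_extension _ (circGroup B) L (fun a => (a : B * B).2)) => //.
  move=> a b La _; rewrite /= -[a * b]/(dbl_circ chi a b) /dbl_circ.
  by rewrite chiK ?(subsetP LK).
move=> M ML M1; suff -> : M :=: 1 by apply: solvable1.
apply/trivgP/subsetP=> -[x y] Mxy; rewrite inE; apply/eqP.
have := L1 _ (subsetP ML _ Mxy); have := M1 _ Mxy; rewrite /=.
by move=> -> ->.
Qed.

(** * Identification of the additive group with a power of A_4 *)

(** Coordinates are indexed by [nat], with only those below [n] relevant, so that doubling is index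
    arithmetic. Surjectivity is replaced by the cardinality. *)
Record a4_power (B : finSkewBrace) (n : nat)
    (f : addGroup B -> nat -> {perm 'I_4}) : Prop := A4Power {
  ap_morph : forall x y k, f (x * y) k = f x k * f y k;
  ap_inj : forall x y, (forall k, k < n -> f x k = f y k) -> x = y;
  ap_even : forall x k, f x k \in 'Alt_('I_4);
  ap_card : #|B| = (12 ^ n)%N
}.

Lemma card_Alt4 : #|'Alt_('I_4)| = 12%N.
Proof. by apply: double_inj; rewrite -mul2n card_Alt card_ord. Qed.

Lemma a4_power_isog B n f : @a4_power B n f ->
  [set: addGroup B] \isog setXn (fun _ : 'I_n => ('Alt_('I_4))%G).
Proof.
case=> fM f_inj fA cardB.
pose F (x : addGroup B) : {dffun forall _ : 'I_n, {perm 'I_4}} :=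
  [ffun k : 'I_n => f x k].
have FM : {in [set: addGroup B] &, {morph F : x y / x * y}}.
  by move=> x y _ _; apply/ffunP=> k; rewrite !ffunE fM.
have injF : 'injm (Morphism FM).
  apply/injmP=> x y _ _ /= /ffunP Fxy; apply: f_inj => k lt_kn.
  by have := Fxy (Ordinal lt_kn); rewrite !ffunE.
apply/isogP; exists (Morphism FM) => //.
apply/eqP; rewrite eqEcard; apply/andP; split.
  apply/subsetP=> _ /morphimP[x _ _ ->]; apply/setXnP=> k /=.
  by rewrite ffunE fA.
rewrite card_injm // cardsXn cardsT prod_nat_const card_ord /= card_Alt4.
by rewrite -cardB; apply: (@leq_card B (addGroup B) id).
Qed.

Lemma dbl_a4_power (B : finSkewBrace) (chi : B -> bool)
    (chiM : forall a b, chi (sb_circ a b) = chi a (+) chi b) n f :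
  @a4_power B n f -> exists g, @a4_power (dbl chiM) n.*2 g.
Proof.
case=> fM f_inj fA cardB.
exists (fun (z : addGroup (dbl chiM)) k =>
  if k < n then f (z : B * B).1 k else f (z : B * B).2 (k - n)%N).
split.
- elim/dblp_ind=> x y; elim/dblp_ind=> x' y' k; rewrite dblpM /=.
  by case: ifP => _; apply: fM.
- elim/dblp_ind=> x y; elim/dblp_ind=> x' y' /= h; congr (dblp _ _ _).
    apply: f_inj => k lt_kn; have := h k; rewrite lt_kn; apply.
    by rewrite -addnn ltn_addl.
  apply: f_inj => k lt_kn; have := h (n + k)%N.
  by rewrite -addnn ltn_add2l lt_kn ltnNge leq_addr addKn; apply.
- by move=> z k; case: ifP.
by rewrite card_prod cardB -expnD addnn.
Qed.

Definition klein_pt (i : 'I_4) : klein := (odd i, odd i./2).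
Definition pt_klein (v : klein) : 'I_4 :=
  match v with
  | (false, false) => @Ordinal 4 0 isT
  | (true, false) => @Ordinal 4 1 isT
  | (false, true) => @Ordinal 4 2 isT
  | (true, true) => @Ordinal 4 3 isT
  end.

Lemma klein_ptK : cancel klein_pt pt_klein.
Proof. by case=> [[|[|[|[|]]]] ?] //; apply: val_inj. Qed.

Lemma pt_kleinK : cancel pt_klein klein_pt.
Proof. by case=> [[] []]. Qed.

(** A_4 as affine maps of the plane F_2^2, whose four points are numbered in binary. *)
Definition a4_act (a : a4) (i : 'I_4) : 'I_4 :=
  pt_klein (add4 a.1 (turn a.2 (klein_pt i))).

Lemma a4_actM (a b : A4) i : a4_act (a * b) i = a4_act a (a4_act b i).
Proof.
rewrite /a4_act pt_kleinK; congr pt_klein.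
by case: (klein_pt i); case: a => [[[] []] [[]|]]; case: b => [[[] []] [[]|]] [] [].
Qed.

Lemma a4_act1 i : a4_act (1 : A4) i = i.
Proof. by rewrite -[RHS]klein_ptK /a4_act /=; case: (klein_pt i) => [[] []]. Qed.

Lemma a4_act_inj (a : A4) : injective (a4_act a).
Proof. by apply: (can_inj (g := a4_act a^-1)) => i; rewrite -a4_actM mulVg a4_act1. Qed.

(** The inverse compensates for products of permutations composing from left to right. *)
Definition a4_perm (a : A4) : {perm 'I_4} := perm (@a4_act_inj a^-1).

Lemma a4_permM (a b : A4) : a4_perm (a * b) = a4_perm a * a4_perm b.
Proof. by apply/permP=> i; rewrite permM !permE invMg a4_actM. Qed.

(** Every element of A_4 is a product of two squares, and squares are even. *)
Lemma a4_perm_even a : a4_perm a \in 'Alt_('I_4).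
Proof.
have key : forall a : A4,
    has (fun b : A4 => has (fun c : A4 => a == (b * b) * (c * c)) a4_enum) a4_enum.
  by apply: a4_all; vm_compute.
have /hasP[b _ /hasP[c _ /eqP->]] := key a.
by rewrite Alt_even !a4_permM !odd_permM !addbb.
Qed.

Lemma a4_perm_inj : injective a4_perm.
Proof.
have key : forall a b : A4, (a == b) || has (fun v : klein =>
    add4 (a : a4).1 (turn (a : a4).2 v) != add4 (b : a4).1 (turn (b : a4).2 v))
    [seq (x, y) | x <- [:: false; true], y <- [:: false; true]].
  by apply: a4_all2; vm_compute.
move=> a b /permP ab; apply: invg_inj.
case/orP: (key a^-1 b^-1) => [/eqP // | /hasP[v _ /eqP[]]].
have := ab (pt_klein v); rewrite !permE /a4_act pt_kleinK.
exact: (can_inj pt_kleinK).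
Qed.

Lemma a4_a4_power : @a4_power a4_brace 1 (fun a _ => a4_perm a).
Proof.
split=> [x y k|x y|x k|]; first exact: a4_permM.
- by move/(_ 0%N isT)/a4_perm_inj.
- exact: a4_perm_even.
by rewrite /= !card_prod card_option !card_bool.
Qed.

Lemma a4_solvable : solvable [set: circGroup a4_brace].
Proof.
apply: (@solvable_extension _ _ [set: circGroup a4_brace]%G a4_chi).
- by move=> a b _ _; apply: a4_chiM.
- exact: bool_solvable.
(* Between even elements [a4_circ] is the direct product law of V_4 and C_3, so the kernel is
   abelian. *)
move=> K _ chiK; apply: abelian_sol; apply/centsP=> a Ka b Kb.
have : a4_chi a || a4_chi b || (a4_circ a b == a4_circ b a).
  by move: a b {Ka Kb}; apply: a4_all2; vm_compute.
by rewrite !chiK //= => /eqP.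
Qed.

(** * Induction along the tower of doublings *)

Definition tower_step (n : nat) (B : finSkewBrace) : Prop :=
  exists (chi : B -> bool) (chiM : forall a b, chi (sb_circ a b) = chi a (+) chi b)
    (V : {group addGroup B}) (f : addGroup B -> nat -> {perm 'I_4}),
  [/\ three_step chi V, splitting chiM V, a4_power n f
    & solvable [set: circGroup B]].

Lemma a4_tower_step : tower_step 1 a4_brace.
Proof.
exists a4_chi, a4_chiM, [group of a4_V], (fun a _ => a4_perm a).
split; [exact: a4_three_step | exact: a4_splitting | exact: a4_a4_power
  | exact: a4_solvable].
Qed.

Lemma dbl_tower_step n B : tower_step n B -> exists BB, tower_step n.*2 BB.
Proof.
case=> chi [chiM [V [f [tsV splitV fB solB]]]].
have [g gB] := dbl_a4_power chiM fB.
have [u neg] := ts_neg tsV.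
pose BB := dbl chiM.
pose psi : BB -> bool := dbl_chi chi.
have psiM a b : psi (sb_circ a b) = psi a (+) psi b by apply: dbl_chiM.
have tsVV : @three_step BB psi (dbl_group chiM V) by apply: dbl_three_step.
exists BB, psi, psiM, (dbl_group chiM V), g.
split=> //; last exact: dbl_solvable.
(* The pair [(u, u)] is even whatever the parity of [u], and still acts as -1, so after one doubling
   [splitting_neg] always applies. *)
apply: (@splitting_neg BB psi psiM _ tsVV (dblp chiM u u)).
  by rewrite /psi /dbl_chi addbb.
elim/dblp_ind=> x y; rewrite dblp_lam addbb dblpM in_dbl_group.
by rewrite !neg.
Qed.

Theorem corollary5p2 (m : nat) :
  exists B : finSkewBrace,
    [/\ simple_brace B,
        [set: addGroup B] \isog setXn (fun _ : 'I_(2 ^ m) => ('Alt_('I_4))%G)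
      & solvable [set: circGroup B]].
Proof.
have [B [chi [chiM [V [f [tsV _ fB solB]]]]]] : exists B, tower_step (2 ^ m) B.
  elim: m => [|m [B stB]]; first by exists a4_brace; apply: a4_tower_step.
  by rewrite expnS mul2n; apply: dbl_tower_step stB.
exists B; split=> //; last exact: a4_power_isog fB.
exact: three_step_simple (chi_zero chiM) tsV.
Qed.
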